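(* Let $K_\varepsilon,K_\sigma\subset\mathbb N$ be finite, let $K:=K_\varepsilon\cap K_\sigma$ (nonempty), and put $\delta_K:=(1\vee\log|K|)^{1/4}$, $\delta_\varepsilon:=(1\vee\log|K_\varepsilon|)^{1/4}$, $\delta_\sigma:=(1\vee\log|K_\sigma|)^{1/4}$. Assume there exists $c_K\ge1$ such that for all $a\in\mathcal A$ and $v\in\mathcal V$ $$\tau^D_{K,a,v}(\delta_K^2\omega_\bullet)\vee\rho^D_{K,a,v}(\delta_K\omega_\bullet)\ \le\ c_K\,\big[\rho^D_{a,v}(\delta_\varepsilon\varepsilon_\bullet)\vee\rho^D_{a,v}(\delta_\sigma^2\theta^\circ\sigma_\bullet)\big].$$ For $\alpha\in(0,1)$ let $\overline A_\alpha\ge0$ be defined by $\overline A_\alpha^2:=r+d\,(5L_{\alpha/2}+15L_{\alpha/2}^2+5)$. Then for all $A\in[\overline A_\alpha,\infty)$ $$\sup_{(a,v)\in\mathcal A\times\mathcal V}\ \mathcal R\big(\varphi^D_{K,\alpha/2}\,|\,\Theta_a^r,\Lambda_v^d,\theta^\circ,\ A\,c_K\,[\rho^D_{a,v}(\delta_\varepsilon\varepsilon_\bullet)\vee\rho^D_{a,v}(\delta_\sigma^2\theta^\circ\sigma_\bullet)]\big)\ \le\ \alpha .$$ Here $\theta^\circ\sigma_\bullet:=(\theta^\circ_j\sigma_j)_j$ and $\varphi^D_{K,\alpha/2}$ is the direct max-test defined in the context.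
   Context: Notation: $\mathbb N=\{1,2,\dots\}$; $x\vee y=\max(x,y)$; operations on sequences are componentwise; $\ell^2$ and $\ell^\infty$ are the spaces of square summable and of bounded real sequences indexed by $\mathbb N$; $L_u:=\sqrt{|\log u|}$ for $u\in(0,1)$; $|K|$ is the cardinality of $K$. Model: $\varepsilon_\bullet=(\varepsilon_j)_{j\in\mathbb N}$ and $\sigma_\bullet=(\sigma_j)_{j\in\mathbb N}$ are known sequences of positive reals (noise levels). For $\theta\in\ell^2$, $\lambda\in\ell^\infty$, $P_{\theta,\lambda}$ is the law of $(Y,X)=((Y_j)_j,(X_j)_j)$ with all coordinates independent, $Y_j\sim N(\lambda_j\theta_j,\varepsilon_j^2)$ and $X_j\sim N(\lambda_j,\sigma_j^2)$ (second parameter = variance). A sequence $\theta^\circ\in\ell^2$ (null hypothesis) is fixed and $\omega_\bullet=(\omega_j)_j$ is given by $\omega_j\ge0$, $\omega_j^2:=\varepsilon_j^2+(\theta^\circ_j)^2\sigma_j^2$. Classes: $\mathcal A$ and $\mathcal V$ are sets of strictly positive, monotonically nonincreasing real sequences bounded by $1$; $r>0$, $d\ge1$; for $a\in\mathcal A$, $v\in\mathcal V$, $$\Theta_a^r:=\Big\{\theta\in\ell^2:\ \sum_{j>k}\theta_j^2\le r a_k^2\ \forall k\in\mathbb N\Big\},\qquad \Lambda_v^d:=\big\{\lambda\in\ell^\infty:\ \lambda_j^2\le d v_j^2\text{ and }v_j^2\le d\lambda_j^2\ \forall j\in\mathbb N\big\}.$$ Risk of a measurable test $\varphi:\mathbb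 R^{\mathbb N}\times\mathbb R^{\mathbb N}\to\{0,1\}$, for $\rho\ge0$: $$\mathcal R(\varphi|\Theta_a^r,\Lambda_v^d,\theta^\circ,\rho):=\sup_{\lambda\in\Lambda_v^d}P_{\theta^\circ,\lambda}(\varphi=1)+\sup\big\{P_{\theta,\lambda}(\varphi=0):\ \theta-\theta^\circ\in\Theta_a^r,\ \|\theta-\theta^\circ\|_{\ell^2}\ge\rho,\ \lambda\in\Lambda_v^d\big\}.$$ Direct radii (all nonnegative), for a real sequence $x_\bullet$: $$\rho^D_{a,v}(x_\bullet)^2:=\min_{k\in\mathbb N}\Big\{v_k^{-2}\Big(\sum_{j\le k}x_j^4\Big)^{1/2}\vee a_k^2\Big\},\quad \rho^D_{K,a,v}(x_\bullet)^2:=\min_{k\in K}\Big\{v_k^{-2}\Big(\sum_{j\le k}x_j^4\Big)^{1/2}\vee a_k^2\Big\},\quad \tau^D_{K,a,v}(x_\bullet)^2:=\min_{k\in K}\Big\{v_k^{-2}\max_{j\le k}x_j^2\vee a_k^2\Big\}$$ (the first read as an infimum if not attained). Direct max-test: for $u\in(0,1)$, $k\in\mathbb N$ let $$S^D_{k,u}:=\sum_{j\le k}\big((Y_j-\theta^\circ_jX_j)^2-\omega_j^2\big)-2L_u\Big(\sum_{j\le k}\omega_j^4\Big)^{1/2}-2L_u^2\max_{j\le k}\omega_j^2,$$ and $\varphi^D_{K,u}:=\mathbf 1\{\max_{k\in K}S^D_{k,u/|K|}>0\}$. *)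

(* Defs.v *)
From HB Require Import structures.
From mathcomp Require Import all_boot all_order all_algebra finmap.
From mathcomp Require Import all_classical all_reals all_analysis.
From mathcomp Require Import measurable_realfun.

Set Implicit Arguments.
Unset Strict Implicit.
Unset Printing Implicit Defensive.
Import Order.TTheory GRing.Theory Num.Theory.
Import numFieldNormedType.Exports.
Local Open Scope classical_set_scope.
Local Open Scope ring_scope.

(* Sequences indexed by {1, 2, ...} are functions on [nat], with j : nat
   standing for the index j + 1.  Indices are only ever compared with one
   another: "j <= k" becomes [j < k.+1] and "j > k" becomes [k.+1 <= j]. *)

Section SequenceSpaces.
Context {R : realType}.
Implicit Types x : nat -> R.

Definition ell2_sqnorm x : \bar R := (\sum_(0 <= j <oo) (x j ^+ 2)%:E)%E.

Definition ell2 : set (nat -> R) := [set x | (ell2_sqnorm x < +oo)%E].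

Definition ell2_norm x : R := Num.sqrt (fine (ell2_sqnorm x)).

Definition ellinfty : set (nat -> R) :=
  [set x | exists M, forall j, `|x j| <= M].

Definition weight_seq x :=
  [/\ forall j, 0 < x j, nonincreasing_seq x & forall j, x j <= 1].

Definition Theta_class (r : R) (a : nat -> R) : set (nat -> R) :=
  [set theta | ell2 theta /\
    forall k, (\sum_(k.+1 <= j <oo) (theta j ^+ 2)%:E <= (r * a k ^+ 2)%:E)%E].

Definition Lambda_class (d : R) (v : nat -> R) : set (nat -> R) :=
  [set lambda | ellinfty lambda /\
    forall j, lambda j ^+ 2 <= d * v j ^+ 2 /\ v j ^+ 2 <= d * lambda j ^+ 2].

Definition coordinate_events : set (set (nat -> R)) :=
  [set E | exists j (B : set R), measurable B /\ E = [set x | B (x j)]].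

End SequenceSpaces.

(* R^N with the product sigma-algebra; R^N x R^N then carries the library's
   product sigma-algebra of two measurable types. *)
Notation seq_space R := (g_sigma_algebraType (@coordinate_events R)).
Notation obs_space R := (seq_space R * seq_space R)%type.

Section Observations.
Context {R : realType}.

(* An observation w is the pair (Y, X). *)
Definition obsY (j : nat) (w : obs_space R) : R := (w.1 : nat -> R) j.
Definition obsX (j : nat) (w : obs_space R) : R := (w.2 : nat -> R) j.

Definition obs_coord (i : nat + nat) : obs_space R -> R :=
  match i with inl j => obsY j | inr j => obsX j end.

Lemma measurable_seq_coord (j : nat) :
  measurable_fun [set: seq_space R] (fun x : seq_space R => (x j : R)).
Proof.
move=> _ B mB; rewrite setTI; apply: sub_sigma_algebra.
by exists j, B.
Qed.

Lemma measurable_obsY j : measurable_fun setT (obsY j).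
Proof. exact: (measurableT_comp (measurable_seq_coord j) measurable_fst). Qed.

Lemma measurable_obsX j : measurable_fun setT (obsX j).
Proof. exact: (measurableT_comp (measurable_seq_coord j) measurable_snd). Qed.

End Observations.

Section Model.
Context {R : realType}.

Definition mutually_independent d (T : measurableType d) (P : probability T R)
    (I : choiceType) (Z : I -> T -> R) : Prop :=
  forall (J : {fset I}) (B : I -> set R), (forall i, measurable (B i)) ->
    P (\bigcap_(i in [set` J]) (Z i @^-1` B i)) =
    (\prod_(i <- J) P (Z i @^-1` B i))%E.

(* The second parameter of [normal_prob] is the standard deviation. *)
Definition normal_rv d (T : measurableType d) (P : probability T R)
    (Z : T -> R) (m s : R) : Prop :=
  forall B : set R, measurable B -> P (Z @^-1` B) = normal_prob m s B.

Definition is_obs_law (eps sig theta lambda : nat -> R)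
    (P : probability (obs_space R) R) : Prop :=
  [/\ mutually_independent P obs_coord,
      forall j, normal_rv P (obsY j) (lambda j * theta j) (eps j) &
      forall j, normal_rv P (obsX j) (lambda j) (sig j)].

(* [P theta lambda] is the law of (Y, X) with parameters theta and lambda; it
   is unconstrained outside the parameter space. *)
Definition sequence_model (eps sig : nat -> R)
    (P : (nat -> R) -> (nat -> R) -> probability (obs_space R) R) : Prop :=
  forall theta lambda, ell2 theta -> ellinfty lambda ->
    is_obs_law eps sig theta lambda (P theta lambda).

Definition risk (P : (nat -> R) -> (nat -> R) -> probability (obs_space R) R)
    (phi : {mfun obs_space R >-> bool}) (Theta Lambda : set (nat -> R))
    (theta0 : nat -> R) (rho : R) : \bar R :=
  (ereal_sup [set P theta0 lambda [set w | phi w = true]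
             | lambda in Lambda] +
   ereal_sup [set P tl.1 tl.2 [set w | phi w = false]
             | tl in [set tl : (nat -> R) * (nat -> R) |
                           [/\ Theta (tl.1 \- theta0)%R,
                               (rho <= ell2_norm (tl.1 \- theta0))%R &
                               Lambda tl.2]]])%E.

End Model.

Section Radii.
Context {R : realType}.
Implicit Types (x a v : nat -> R) (K : set nat).

(* [sup] and [inf] over a nonempty finite set of reals are its maximum and its
   minimum.  The index set [setT] gives the radius over all of N. *)
Definition rhoD K a v x : R :=
  Num.sqrt (inf [set Num.max ((v k ^+ 2)^-1 *
                              Num.sqrt (\sum_(j < k.+1) x j ^+ 4))
                             (a k ^+ 2) | k in K]).

(* The default value 0 of the maximum is harmless: the terms are squares. *)
Definition max_sq x k : R := \big[Num.max/0]_(j < k.+1) (x j ^+ 2).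

Definition tauD K a v x : R :=
  Num.sqrt (inf [set Num.max ((v k ^+ 2)^-1 * max_sq x k) (a k ^+ 2)
                | k in K]).

End Radii.

Section MaxTest.
Context {R : realType}.
Implicit Types (u : R) (K : {fset nat}).

Definition Lfun u : R := Num.sqrt `|ln u|.

Definition delta K : R := Num.max 1 (ln #|` K|%:R) `^ (4^-1).

Variables eps sig theta0 : nat -> R.

Definition omega j : R := Num.sqrt (eps j ^+ 2 + theta0 j ^+ 2 * sig j ^+ 2).

Definition direct_stat (k : nat) u (w : obs_space R) : R :=
  \sum_(j < k.+1) ((obsY j w - theta0 j * obsX j w) ^+ 2 - omega j ^+ 2)
  - 2 * Lfun u * Num.sqrt (\sum_(j < k.+1) omega j ^+ 4)
  - 2 * Lfun u ^+ 2 * max_sq omega k.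

Definition max_test K u (w : obs_space R) : bool :=
  0 < sup [set direct_stat k (u / #|` K|%:R) w | k in [set` K]].

Lemma measurable_direct_stat k u : measurable_fun setT (direct_stat k u).
Proof.
apply: measurable_funB => //; apply: measurable_funB => //.
apply: measurable_sum => j; apply: measurable_funB => //.
apply: measurable_funX; apply: measurable_funB; first exact: measurable_obsY.
by apply: measurable_funM => //; exact: measurable_obsX.
Qed.

Lemma max_testP K u w :
  max_test K u w <->
  exists2 k, k \in K & 0 < direct_stat k (u / #|` K|%:R) w.
Proof.
rewrite /max_test; set f := fun k => direct_stat k _ w; split.
- have [->|[k kK]] := fset_0Vmem K.
    by rewrite set_fset0 image_set0 sup0 ltxx.
  case/sup_gt; first by exists (f k); exists k.
  by move=> _ [j jK <-] fj; exists j.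
- move=> [k kK fk]; apply: lt_le_trans fk _; apply: ub_le_sup; last by exists k.
  exists (\sum_(j <- K) `|f j|) => _ [j jK <-].
  rewrite (le_trans (ler_norm _))// (big_fsetD1 j)//= lerDl.
  exact: sumr_ge0.
Qed.

Lemma measurable_max_test K u : measurable_fun setT (max_test K u).
Proof.
apply: (measurable_fun_bool true); rewrite setTI.
rewrite (_ : _ @^-1` _ = \bigcup_(k in [set` K])
    [set w | 0 < direct_stat k (u / #|` K|%:R) w]); last first.
  apply/seteqP; split => w /=.
    by move=> /max_testP[k kK fk]; exists k.
  by move=> [k kK fk]; apply/max_testP; exists k.
apply: bigcup_measurable => k _.
rewrite -[X in measurable X]setTI.
rewrite (_ : [set w | _] =
    direct_stat k (u / #|` K|%:R) @^-1` [set` `]0, +oo[]); last first.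
  by apply/seteqP; split => w /=; rewrite in_itv/= andbT.
exact: measurable_direct_stat.
Qed.

HB.instance Definition _ K u :=
  isMeasurableFun.Build _ _ _ _ (max_test K u) (measurable_max_test K u).

End MaxTest.

Definition rhoD_inflated {R : realType} (eps sig theta0 : nat -> R)
    (Keps Ksig : {fset nat}) (a v : nat -> R) : R :=
  Num.max
    (rhoD setT a v (fun j => delta Keps * eps j))
    (rhoD setT a v (fun j => delta Ksig ^+ 2 * (theta0 j * sig j))).

Definition Abar {R : realType} (r d alpha : R) : R :=
  Num.sqrt (r + d * (5 * Lfun (alpha / 2) + 15 * Lfun (alpha / 2) ^+ 2 + 5)).

(* Main.v *)
(** Under [P_(theta, lambda)] the variables [Z_j = Y_j - theta0_j X_j] are
    independent with mean [mu_j = lambda_j (theta_j - theta0_j)] and variance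
    [omega_j^2].  Integrating out [X_j] and then [Y_j] gives the Laplace
    transform of [S = \sum_(j <= k) Z_j^2] in closed form, without computing the
    law of [Z_j].  With [Q^2 = \sum_(j <= k) omega_j^4] and
    [M = max_(j <= k) omega_j^2], Chernoff's method yields, for [L > 0],
      P(S - \sum omega_j^2 >= 2 L Q + 2 L^2 M) <= exp(- L^2)   when mu = 0, and
      P(S - \sum (omega_j^2 + mu_j^2) <= - 2 L sqrt V) <= exp(- L^2),
        V = \sum (omega_j^4 + 2 omega_j^2 mu_j^2).
    The first bound and a union bound over [K] control the error of the first
    kind.  For the error of the second kind it suffices that a single [k] in
    [K] rejects.  A [k] at which both radii over [K] are controlled satisfies
    [\sum_(j <= k) mu_j^2 >= C B], where [C = 5 L + 15 L^2 + 5] and [B] dominates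
    [delta_K^2 Q] and [delta_K^4 M]; this signal exceeds the threshold plus the
    deviation [2 L sqrt V]. *)
Require Import Defs.
From HB Require Import structures.
From mathcomp Require Import all_boot all_order all_algebra finmap.
From mathcomp Require Import all_classical all_reals all_analysis.
From mathcomp Require Import measurable_realfun ring lra.
Set Implicit Arguments.
Unset Strict Implicit.
Unset Printing Implicit Defensive.
Import Order.TTheory GRing.Theory Num.Theory.
Import numFieldNormedType.Exports.
Local Open Scope fset_scope.
Local Open Scope classical_set_scope.
Local Open Scope ring_scope.

(** * Densities and Gaussian integrals *)

Section density.
Local Open Scope ereal_scope.
Context d (T : measurableType d) (R : realType).
Variables (mu nu : {measure set T -> \bar R}) (g : T -> R).
Hypotheses (mg : measurable_fun [set: T] g) (g0 : forall x, (0 <= g x)%R).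
Hypothesis nuE : forall A, measurable A -> nu A = \int[mu]_(x in A) (g x)%:E.

Import HBNNSimple.

Let integral_density_nnsfun (h : {nnsfun T >-> R}) :
  \int[nu]_x (h x)%:E = \int[mu]_x (h x * g x)%:E.
Proof.
rewrite integralT_nnsfun sintegralE.
transitivity (\sum_(y \in range h)
    \int[mu]_x (y * \1_(h @^-1` [set y]) x * g x)%:E).
  apply: eq_fsbigr => y; rewrite inE => -[z _ <-{y}].
  have -> : nu (h @^-1` [set h z]) =
      \int[mu]_x (\1_(h @^-1` [set h z]) x * g x)%:E.
    rewrite nuE// integral_mkcond; apply: eq_integral => x _.
    by rewrite patchE indicE; case: ifPn => _; rewrite ?mul1r// mul0r.
  rewrite -ge0_integralZl//.
  - by apply: eq_integral => x _; rewrite -EFinM mulrA.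
  - by apply/measurable_EFinP/measurable_funM => //; exact: measurable_indic.
  - by move=> x _; rewrite lee_fin mulr_ge0.
  - by rewrite lee_fin.
rewrite -ge0_integral_fsum//; last 2 first.
- move=> y; apply/measurable_EFinP; apply: measurable_funM => //.
  exact: measurable_funM.
- by move=> y x _; rewrite EFinM mule_ge0//; [exact: nnfun_muleindic_ge0|rewrite lee_fin].
apply: eq_integral => x _; rewrite fimfunE fsumEFin// mulr_fsuml//.
Qed.

(** Simple functions come first, and [nnsfun_approx] with monotone convergence on both sides gives
    the rest; [g >= 0] keeps the products [f_ n x * g x] nondecreasing in [n]. *)
Lemma ge0_integral_density (f : T -> R) :
  measurable_fun [set: T] f -> (forall x, (0 <= f x)%R) ->
  \int[nu]_x (f x)%:E = \int[mu]_x (f x * g x)%:E.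
Proof.
move=> /measurable_EFinP mf f0.
have Ef0 x : setT x -> 0 <= (EFin \o f) x by rewrite lee_fin.
pose f_ := nnsfun_approx measurableT mf.
have f_cvg x : (f_ n x)%:E @[n --> \oo] --> (f x)%:E.
  exact: (@cvg_nnsfun_approx _ _ _ _ measurableT _ mf).
have f_nd x a b : (a <= b)%N -> (f_ a x <= f_ b x)%R.
  by move=> ab; exact/lefP/nd_nnsfun_approx.
transitivity (limn (fun n => \int[nu]_x (f_ n x)%:E)).
  rewrite -monotone_convergence//.
  - by apply: eq_integral => x _; apply/esym/cvg_lim.
  - by move=> n; exact/measurable_EFinP.
  - by move=> n x _; rewrite lee_fin.
  - by move=> x _ a b ab; rewrite lee_fin f_nd.
under eq_fun do rewrite integral_density_nnsfun.
rewrite -monotone_convergence//.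
- apply: eq_integral => x _; apply/cvg_lim => //.
  under eq_fun do rewrite EFinM.
  by rewrite EFinM; apply: cvgeZr.
- by move=> n; apply/measurable_EFinP; exact: measurable_funM.
- by move=> n x _; rewrite lee_fin mulr_ge0.
- by move=> x _ a b ab; rewrite lee_fin ler_wpM2r// f_nd.
Qed.
End density.

Lemma integral_normal_probE (R : realType) (m s : R) (f : R -> R) :
  measurable_fun [set: R] f -> (forall x, 0 <= f x) ->
  (\int[normal_prob m s]_x (f x)%:E =
   \int[lebesgue_measure]_x (f x * normal_pdf m s x)%:E)%E.
Proof.
move=> mf f0; apply: ge0_integral_density => //.
- exact: measurable_normal_pdf.
- by move=> x; exact: normal_pdf_ge0.
Qed.

(** Exponent identity for tilting a normal density by [expR (- t * (b * x - c) ^+ 2)]: the result is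
    again a Gaussian kernel in [x], with variance [s ^+ 2 / D], up to a factor free of [x]. *)
Lemma complete_square (R : realFieldType) (m s b c t x : R) :
  s != 0 -> 1 + 2 * t * (b ^+ 2 * s ^+ 2) != 0 ->
  let D := 1 + 2 * t * (b ^+ 2 * s ^+ 2) in
  - t * (b * x - c) ^+ 2 + - (x - m) ^+ 2 / (s ^+ 2 *+ 2) =
  - (t / D) * (b * m - c) ^+ 2
    + - (x - (m + 2 * t * s ^+ 2 * b * c) / D) ^+ 2 / (s ^+ 2 / D *+ 2).
Proof.
move=> s0 D0 D.
have s20 : s ^+ 2 *+ 2 != 0 by rewrite mulrn_eq0 sqrf_eq0 negb_or.
rewrite -mulrnAl invf_div; set w := (s ^+ 2 *+ 2)^-1.
set u := 2 * t * s ^+ 2.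
have tE : t = u * w by rewrite -(mulfK s20 t) /u -mulr_natr; congr (_ / _); ring.
have DE : D = 1 + u * b ^+ 2 by rewrite /D /u; ring.
rewrite {1 2}tE; clearbody w u.
rewrite -/D in D0; rewrite DE in D0 *; clear D DE tE s20.
have {}D0 : (1 + u * b ^+ 2) * (1 + u * b ^+ 2)^-1 = 1 by rewrite mulfV.
(* The inverse of [D] becomes an indeterminate [i] subject only to [D i = 1], so that [ring]
   suffices from here. *)
move: (_^-1) D0 => i D0.
have -> : x - (m + u * b * c) * i = ((1 + u * b ^+ 2) * x - (m + u * b * c)) * i.
  by rewrite [RHS]mulrBl (mulrAC _ x) D0 mul1r.
have -> : - (((1 + u * b ^+ 2) * x - (m + u * b * c)) * i) ^+ 2 * ((1 + u * b ^+ 2) * w) =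
  - ((1 + u * b ^+ 2) * x - (m + u * b * c)) ^+ 2 * i * w *
    ((1 + u * b ^+ 2) * i) by ring.
rewrite D0 mulr1; transitivity ((- (u * w) * (b * x - c) ^+ 2 - (x - m) ^+ 2 * w)
  * ((1 + u * b ^+ 2) * i)); [by rewrite D0 mulr1 (mulNr _ w)|ring].
Qed.

(** The tilted density is a constant times the density of the normal law with mean [m'] and standard
    deviation [s / Num.sqrt D], which integrates to 1. Negative [t] is allowed as long as [D] stays
    positive; the upper tail relies on this. *)
Lemma integral_normal_expR_sqr (R : realType) (m s b c t : R) : 0 < s ->
  let D := 1 + 2 * t * (b ^+ 2 * s ^+ 2) in 0 < D ->
  (\int[normal_prob m s]_x (expR (- t * (b * x - c) ^+ 2))%:E =
   ((Num.sqrt D)^-1 * expR (- (t / D) * (b * m - c) ^+ 2))%:E)%E.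
Proof.
move=> s0 D D0.
have mf : measurable_fun [set: R] (fun x : R => expR (- t * (b * x - c) ^+ 2)).
  apply: measurableT_comp => //; apply: measurable_funM => //.
  by apply: measurable_funX; apply: measurable_funB => //; exact: measurable_funM.
rewrite integral_normal_probE//.
pose s' := s / Num.sqrt D.
pose m' := (m + 2 * t * s ^+ 2 * b * c) / D.
have sD0 : 0 < Num.sqrt D by rewrite sqrtr_gt0.
have s'0 : 0 < s' by rewrite divr_gt0.
have s'2 : s' ^+ 2 = s ^+ 2 / D by rewrite expr_div_n sqr_sqrtr// ltW.
set k := (_ * _).
transitivity (\int[lebesgue_measure]_x (k%:E * (normal_pdf m' s' x)%:E))%E; last first.
  rewrite ge0_integralZl//.
  - by rewrite integral_normal_pdf mule1.
  - by apply/measurable_EFinP; exact: measurable_normal_pdf.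
  - by move=> x _; rewrite lee_fin normal_pdf_ge0.
  - by rewrite lee_fin mulr_ge0// expR_ge0.
apply: eq_integral => x _; rewrite -EFinM; congr EFin.
rewrite !normal_pdfE ?gt_eqF// /normal_peak /normal_fun.
rewrite s'2 /k.
have -> : Num.sqrt (s ^+ 2 / D * pi *+ 2) = Num.sqrt (s ^+ 2 * pi *+ 2) / Num.sqrt D.
  rewrite -sqrtrV ?ltW// -sqrtrM; last by rewrite mulrn_wge0// mulr_ge0 ?sqr_ge0 ?pi_ge0.
  by rewrite (mulrAC _ D^-1) mulrnAl.
rewrite invf_div; set p := Num.sqrt (_ *+ _).
have sp : (Num.sqrt D)^-1 * (Num.sqrt D / p) = p^-1 by rewrite mulKf ?gt_eqF.
rewrite mulrCA -expRD mulrACA sp -expRD.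
congr (_ * expR _); rewrite /m'.
by rewrite complete_square ?gt_eqF.
Qed.

(** * Independence *)

Lemma measurable_preimage d d' (T : measurableType d) (T' : measurableType d')
    (U : T -> T') A :
  measurable_fun [set: T] U -> measurable A -> measurable (U @^-1` A).
Proof. by move=> mU mA; rewrite -[X in measurable X]setTI; exact: mU. Qed.

Section pair_mfun.
Context d d1 d2 (T : measurableType d) (T1 : measurableType d1)
  (T2 : measurableType d2) (U : {mfun T >-> T1}) (Z : {mfun T >-> T2}).

Definition pair_mfun w := (U w, Z w).

Let measurable_pair_mfun : measurable_fun [set: T] pair_mfun.
Proof. exact: measurable_fun_pair. Qed.

HB.instance Definition _ :=
  isMeasurableFun.Build _ _ _ _ pair_mfun measurable_pair_mfun.

End pair_mfun.

Section indep_event_pair.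
Local Open Scope ereal_scope.
Context d (T : measurableType d) (R : realType) (P : probability T R).
Context d1 d2 (T1 : measurableType d1) (T2 : measurableType d2).
Variables (U : {mfun T >-> T1}) (Z : {mfun T >-> T2}).

Local Notation UZ := (pair_mfun U Z).

(** As functions of [D], both sides are measures that agree on rectangles with the product of the
    law of [U] and the law of [Z] scaled by [P E]; uniqueness of the product measure concludes. *)
Lemma indep_event_pair (E : set T) : measurable E ->
  (forall A B, measurable A -> measurable B ->
     P (U @^-1` A `&` (Z @^-1` B `&` E)) = P (U @^-1` A) * (P (Z @^-1` B) * P E)) ->
  (forall A B, measurable A -> measurable B ->
     P (U @^-1` A `&` Z @^-1` B) = P (U @^-1` A) * P (Z @^-1` B)) ->
  forall D, measurable D -> P (UZ @^-1` D `&` E) = P (UZ @^-1` D) * P E.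
Proof.
move=> mE UZE UZ1 D mD.
have PE0 : (0 <= fine (P E))%R by exact: fine_ge0.
pose e := NngNum PE0.
have PEE : e%:num%:E = P E by rewrite fineK// fin_num_measure.
have @m1 : {measure set (T1 * T2) -> \bar R}.
  by refine (pushforward (mrestr P mE) UZ : {measure set _ -> \bar R}).
pose m2 : {measure set (T1 * T2) -> \bar R} := mscale e (distribution P UZ).
transitivity (m1 D); first by [].
rewrite -PEE muleC; transitivity (m2 D); last by [].
rewrite -(@product_measure_unique _ _ _ _ _ (distribution P U)
    (mscale e (distribution P Z)) m1)//.
  rewrite (@product_measure_unique _ _ _ _ _ (distribution P U)
    (mscale e (distribution P Z)) m2)//.
  move=> A B mA mB.
  transitivity (e%:num%:E * P (U @^-1` A `&` Z @^-1` B)); first by [].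
  by rewrite UZ1// muleCA.
move=> A B mA mB.
transitivity (P (U @^-1` A `&` Z @^-1` B `&` E)); first by [].
by rewrite -setIA UZE// (muleC _ (P E)) -PEE.
Qed.

(** Independence makes the joint law a product measure, and Tonelli then integrates [Z] out with [U]
    held fixed. *)
Lemma ge0_integral_indep_pair (f : T1 * T2 -> \bar R) :
  (forall A B, measurable A -> measurable B ->
     P (U @^-1` A `&` Z @^-1` B) = P (U @^-1` A) * P (Z @^-1` B)) ->
  measurable_fun [set: T1 * T2] f -> (forall x, 0 <= f x) ->
  \int[P]_w f (U w, Z w) = \int[P]_w \int[distribution P Z]_z f (U w, z).
Proof.
move=> UZ1 mf f0.
rewrite -(@ge0_integral_distribution _ _ _ _ _ P U
  (fun u => \int[distribution P Z]_z f (u, z)))//; last 2 first.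
- exact: (measurable_fun_fubini_tonelli_F f).
- by move=> u; exact: integral_ge0.
rewrite -(fubini_tonelli1 f)//.
transitivity (\int[distribution P UZ]_z f z).
  by rewrite ge0_integral_distribution.
apply: eq_measure_integral => D mD _; apply/esym.
exact: (@product_measure_unique _ _ _ _ _ (distribution P U) (distribution P Z)).
Qed.

End indep_event_pair.

Section independence.
Local Open Scope ereal_scope.
Context d (T : measurableType d) (R : realType) (P : probability T R).
Context (I : choiceType) (W : I -> {mfun T >-> R}).

(** [U] may live in any measurable space, so that coordinates can be moved one by one from the free
    list [J] into [U]. *)
Definition indep_family d1 (T1 : measurableType d1) (U : T -> T1) (J : {fset I}) :=
  forall A (B : I -> set R), measurable A -> (forall i, measurable (B i)) ->
    P (U @^-1` A `&` \bigcap_(i in [set` J]) (W i @^-1` B i)) =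
    P (U @^-1` A) * \prod_(i <- J) P (W i @^-1` B i).

Lemma indep_family_comp d1 d2 (T1 : measurableType d1) (T2 : measurableType d2)
    (U : T -> T1) (h : T1 -> T2) J :
  measurable_fun [set: T1] h -> indep_family U J -> indep_family (h \o U) J.
Proof.
move=> mh UJ A B mA mB; rewrite comp_preimage; apply: UJ => //.
exact: measurable_preimage.
Qed.

Lemma indep_family_cst d1 (T1 : measurableType d1) (c : T1) J :
  mutually_independent P W -> indep_family (fun=> c) J.
Proof.
move=> WJ A B mA mB; rewrite preimage_cst; case: ifPn => _.
  by rewrite setTI WJ// probability_setT mul1e.
by rewrite set0I measure0 mul0e.
Qed.

Lemma indep_family1 d1 (T1 : measurableType d1) (U : T -> T1) i :
  indep_family U [fset i] -> forall A B, measurable A -> measurable B ->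
  P (U @^-1` A `&` W i @^-1` B) = P (U @^-1` A) * P (W i @^-1` B).
Proof.
move=> Ui A B mA mB; have := Ui A (fun=> B) mA (fun=> mB).
by rewrite big_seq_fset1 set_fset1 bigcap_set1.
Qed.

Lemma sub_indep_family d1 (T1 : measurableType d1) (U : T -> T1) (J J' : {fset I}) :
  (J' `<=` J)%fset -> indep_family U J -> indep_family U J'.
Proof.
move=> J'J UJ A B mA mB.
(* Dropped coordinates receive the full event, which contributes a factor 1. *)
pose B' i := if i \in J' then B i else setT.
have mB' i : measurable (B' i) by rewrite /B'; case: ifP.
have := UJ A B' mA mB'.
rewrite (_ : \bigcap_(i in [set` J]) _ =
    \bigcap_(i in [set` J']) (W i @^-1` B i)); last first.
  apply/seteqP; split=> w Bw i /= iJ.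
    by have := Bw i (fsubsetP J'J _ iJ); rewrite /B' iJ.
  by rewrite /B'; case: ifPn => // iJ'; exact: Bw.
move=> ->; congr (_ * _).
rewrite (big_fsetID _ (mem J'))/= [X in _ * X]big1_fset ?mule1; last first.
  move=> i; rewrite !inE/= => /andP[_ /negPf iJ'] _.
  by rewrite /B' iJ' preimage_setT probability_setT.
rewrite (_ : [fset x in J | x \in J'] = J')%fset; last first.
  apply/fsetP => i; rewrite !inE/=; apply: andb_idl; exact: (fsubsetP J'J).
rewrite big_seq_cond [RHS]big_seq_cond.
by apply: eq_bigr => i /andP[iJ' _]; rewrite /B' iJ'.
Qed.

(** One coordinate passes from the free list into [U]: [indep_event_pair], with the event of the
    remaining coordinates as [E], extends the factorization from rectangles to all events of the
    pair. *)
Lemma indep_family_pair d1 (T1 : measurableType d1) (U : {mfun T >-> T1}) i J :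
  mutually_independent P W -> i \notin J -> indep_family U (i |` J)%fset ->
  indep_family (pair_mfun U (W i)) J.
Proof.
move=> WJ iJ UJ A B mA mB.
have mE : measurable (\bigcap_(i in [set` J]) (W i @^-1` B i)).
  apply: fin_bigcap_measurable => // j _; exact: measurable_preimage.
rewrite indep_event_pair//.
- by rewrite WJ.
- move=> A' B' mA' mB'.
  pose B'' j := if j == i then B' else B j.
  have mB'' j : measurable (B'' j) by rewrite /B''; case: ifP.
  have B''i : B'' i = B' by rewrite /B'' eqxx.
  have := UJ A' B'' mA' mB''.
  rewrite big_fsetU1//= B''i.
  have ne j : j \in J -> B'' j = B j.
    by rewrite /B''; case: eqP => // ->; rewrite (negbTE iJ).
  rewrite set_fsetU1 bigcap_setU1 B''i.
  rewrite (eq_bigcapr (fun j jJ => congr1 (preimage (W j)) (ne j jJ))) => ->.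
  congr (_ * (_ * _)); rewrite WJ//.
  by rewrite big_seq_cond [RHS]big_seq_cond; apply: eq_bigr => j /andP[jJ' _]; rewrite ne.
- apply: indep_family1; apply: sub_indep_family UJ.
  by rewrite fsub1set !inE eqxx.
Qed.

End independence.

(** * Laplace transform of the sum of squares *)

(* [R] and [measurableTypeR R] carry the same measurable sets under different
   displays, so the change of measure goes through a pushforward by the
   identity. *)
Lemma ge0_integral_normal_rv d (T : measurableType d) (R : realType)
    (P : probability T R) (Z : {mfun T >-> R}) (m s : R) (f : R -> \bar R) :
  normal_rv P Z m s -> measurable_fun [set: R] f -> (forall x, (0 <= f x)%E) ->
  (\int[distribution P Z]_z f z = \int[normal_prob m s]_z f z)%E.
Proof.
move=> ZE mf f0.
pose idTR : measurableTypeR R -> R := idfun.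
have midTR : measurable_fun [set: measurableTypeR R] idTR.
  by move=> _ B mB; rewrite setTI.
transitivity (\int[pushforward (normal_prob m s) idTR]_z f z)%E.
  by apply: eq_measure_integral => B mB _; exact: ZE.
by rewrite ge0_integral_pushforward.
Qed.

(** The coefficients [b] and [c] cover both integrations: first over [X_n] with [b = th n] and [c]
    the value of [Y_n], then over [Y_n] with [b = 1] and [c] constant. *)
Lemma integral_normal_out d d1 (T : measurableType d) (T1 : measurableType d1)
    (R : realType) (P : probability T R) (U : {mfun T >-> T1})
    (Z : {mfun T >-> R}) (m s b t : R) (g c : T1 -> R) :
  (forall A B, measurable A -> measurable B ->
     (P (U @^-1` A `&` Z @^-1` B) = P (U @^-1` A) * P (Z @^-1` B))%E) ->
  normal_rv P Z m s -> 0 < s ->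
  measurable_fun [set: T1] g -> (forall u, 0 <= g u) ->
  measurable_fun [set: T1] c ->
  let D := 1 + 2 * t * (b ^+ 2 * s ^+ 2) in 0 < D ->
  (\int[P]_w (g (U w) * expR (- t * (b * Z w - c (U w)) ^+ 2))%:E =
   \int[P]_w (g (U w) *
     ((Num.sqrt D)^-1 * expR (- (t / D) * (b * m - c (U w)) ^+ 2)))%:E)%E.
Proof.
move=> UZ Zn s0 mg g0 mc D D0.
pose f (x : T1 * R) := (g x.1 * expR (- t * (b * x.2 - c x.1) ^+ 2))%:E.
have mexp a : measurable_fun [set: R] (fun z : R => expR (- t * (b * z - a) ^+ 2)).
  apply: measurableT_comp => //; apply: measurable_funM => //.
  by apply: measurable_funX; apply: measurable_funB => //; exact: measurable_funM.
rewrite (@ge0_integral_indep_pair _ _ _ P _ _ _ _ U Z f UZ); last 2 first.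
- apply/measurable_EFinP; apply: measurable_funM.
    exact: measurableT_comp measurable_fst.
  apply: measurableT_comp => //; apply: measurable_funM => //.
  apply: measurable_funX; apply: measurable_funB.
    exact: measurable_funM.
  exact: measurableT_comp measurable_fst.
- by move=> x; rewrite lee_fin mulr_ge0// expR_ge0.
apply: eq_integral => w _; rewrite /f /=.
under eq_integral do rewrite EFinM.
rewrite ge0_integralZl ?lee_fin//; last exact/measurable_EFinP.
rewrite [RHS]EFinM; congr (_ * _)%E.
rewrite (ge0_integral_normal_rv Zn)//; last first.
- exact/measurable_EFinP.
exact: integral_normal_expR_sqr.
Qed.

Section sum_of_squares.
Context d (T : measurableType d) (R : realType) (W : nat + nat -> {mfun T >-> R}).
Variable th : nat -> R.

Definition sqr_sum n w : R :=
  \sum_(j < n) (W (inl (val j)) w - th j * W (inr (val j)) w) ^+ 2.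

Lemma measurable_sqr_sum n : measurable_fun [set: T] (sqr_sum n).
Proof.
apply: measurable_sum => j; apply: measurable_funX; apply: measurable_funB => //.
exact: measurable_funM.
Qed.

HB.instance Definition _ n :=
  isMeasurableFun.Build _ _ _ _ (sqr_sum n) (measurable_sqr_sum n).

Lemma sqr_sumS n w : sqr_sum n.+1 w =
  sqr_sum n w + (W (inl n) w - th n * W (inr n) w) ^+ 2.
Proof. by rewrite /sqr_sum big_ord_recr. Qed.

Definition coord_index (i : nat + nat) : nat :=
  match i with inl j => j | inr j => j end.

Variables (P : probability T R).
Hypothesis Windep : mutually_independent P W.

(** The sum involves only coordinates of index below [n]. In the inductive step both coordinates of
    index [n] are adjoined to the partial sum, and the map [h] folds the triple into the next
    sum. *)
Lemma sqr_sum_indep n J :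
  (forall i, i \in J -> (n <= coord_index i)%N) -> indep_family P W (sqr_sum n) J.
Proof.
elim: n J => [|n IHn] J HJ.
  rewrite (_ : sqr_sum 0 = fun=> 0); first exact: indep_family_cst.
  by apply/funext => w; rewrite /sqr_sum big_ord0.
have nJ i : i \in J -> (coord_index i == n) = false.
  by move=> /HJ ni; rewrite gtn_eqF.
have yJ : inl n \notin J by apply/negP => /nJ /=; rewrite eqxx.
have xJ : inr n \notin J by apply/negP => /nJ /=; rewrite eqxx.
have IH : indep_family P W (sqr_sum n) (inl n |` (inr n |` J))%fset.
  apply: IHn => i; rewrite !inE => /orP[/eqP->//|/orP[/eqP->//|/HJ]].
  exact: ltnW.
have yJ' : inl n \notin (inr n |` J)%fset by rewrite !inE.
have := indep_family_pair Windep xJ (indep_family_pair Windep yJ' IH).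
pose h (z : R * R * R) : R := z.1.1 + (z.1.2 - th n * z.2) ^+ 2.
have mh : measurable_fun [set: R * R * R] h.
  apply: measurable_funD; first exact: measurableT_comp measurable_fst.
  apply: measurable_funX; apply: measurable_funB.
    exact: measurableT_comp measurable_fst.
  exact: measurable_funM.
move=> /(indep_family_comp mh); congr indep_family.
by apply/funext => w; rewrite sqr_sumS.
Qed.

Variables (mY sY mX sX : nat -> R).
Hypotheses (sY0 : forall j, 0 < sY j) (sX0 : forall j, 0 < sX j).
Hypothesis WY : forall j, normal_rv P (W (inl j)) (mY j) (sY j).
Hypothesis WX : forall j, normal_rv P (W (inr j)) (mX j) (sX j).

Lemma sqr_sum_laplace (t : R) n :
  (forall j, (j < n)%N -> 0 < 1 + 2 * t * (sY j ^+ 2 + th j ^+ 2 * sX j ^+ 2)) ->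
  (\int[P]_w (expR (- t * sqr_sum n w))%:E =
   (\prod_(j < n)
      let D := 1 + 2 * t * (sY j ^+ 2 + th j ^+ 2 * sX j ^+ 2) in
      ((Num.sqrt D)^-1 * expR (- (t / D) * (mY j - th j * mX j) ^+ 2)))%:E)%E.
Proof.
elim: n => [|n IHn] Dpos.
  under eq_integral do rewrite /sqr_sum big_ord0 mulr0 expR0.
  by rewrite big_ord0 integral_cst// mul1e; exact: probability_setT.
rewrite big_ord_recr/=.
have D0 := Dpos n (ltnSn n).
set D := 1 + _ in D0 *.
set D1 := 1 + 2 * t * (th n ^+ 2 * sX n ^+ 2).
have D10 : 0 < D1.
  (* For negative [t] the positivity of [D1] comes from [D <= D1]. *)
  have [t0|t0] := leP 0 t; first by rewrite ltr_wpDr// !(sqr_ge0, mulr_ge0).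
  apply: lt_le_trans D0 _; rewrite /D lerD2l mulrDr gerDr.
  by rewrite nmulr_rle0 ?sqr_ge0// nmulr_llt0.
set t1 := t / D1.
set D2 := 1 + 2 * t1 * (1 ^+ 2 * sY n ^+ 2).
(* This factorization merges the two integrations: the normalizing roots multiply to [Num.sqrt D],
   and [t1 / D2 = t / D]. *)
have DE : D = D1 * D2.
  have t1E : D1 * t1 = t by rewrite mulrC divfK// gt_eqF.
  rewrite /D2 (_ : D1 * _ = D1 + 2 * (D1 * t1) * sY n ^+ 2); last by ring.
  by rewrite t1E /D /D1; ring.
have D20 : 0 < D2 by rewrite -(pmulr_rgt0 _ D10) -DE.
have IS : indep_family P W (sqr_sum n) (inl n |` [fset inr n])%fset.
  by apply: sqr_sum_indep => i; rewrite !inE => /orP[/eqP->|/eqP->].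
have IS1 : indep_family P W (sqr_sum n) [fset inl n].
  by apply: sqr_sum_indep => i; rewrite !inE => /eqP->.
have ISY : indep_family P W (pair_mfun (sqr_sum n) (W (inl n))) [fset inr n].
  by apply: indep_family_pair => //; rewrite !inE.
pose g (u : R * R) := expR (- t * u.1).
have mexp : measurable_fun [set: R] (fun s : R => expR (- t * s)).
  by apply: measurableT_comp => //; exact: measurable_funM.
have mg : measurable_fun [set: R * R] g by exact: measurableT_comp mexp measurable_fst.
under eq_integral => w _.
  rewrite sqr_sumS mulrDr expRD -sqrrN opprB.
  over.
rewrite (@integral_normal_out _ _ _ _ _ P (pair_mfun (sqr_sum n) (W (inl n)))
  (W (inr n)) (mX n) (sX n) (th n) t g snd)//; last first.
- by move=> u; exact: expR_ge0.
- exact: indep_family1.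
rewrite -/D1 -/t1 /=.
pose h (u : R) := expR (- t * u) * (Num.sqrt D1)^-1.
under eq_integral => w _.
  rewrite /g /= mulrA -sqrrN opprB -[X in (X - _) ^+ 2]mul1r.
  over.
rewrite (@integral_normal_out _ _ _ _ _ P (sqr_sum n)
  (W (inl n)) (mY n) (sY n) 1 t1 h (fun=> th n * mX n))//; last first.
- by move=> u; rewrite mulr_ge0// expR_ge0.
- exact: measurable_funM.
- exact: indep_family1.
rewrite -/D2 mul1r /h.
under eq_integral do rewrite -mulrA EFinM.
rewrite ge0_integralZr//; last first.
  by apply/measurable_EFinP; exact: measurableT_comp mexp (measurable_sqr_sum n).
rewrite IHn => [|j jn]; last by apply: Dpos; exact: ltnW.
rewrite -EFinM; congr (_ * _)%:E.
have sqrtDE : (Num.sqrt D1)^-1 * (Num.sqrt D2)^-1 = (Num.sqrt D)^-1.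
  by rewrite -invfM DE sqrtrM// ltW.
have tDE : t1 / D2 = t / D by rewrite /t1 DE invfM mulrA.
by rewrite [LHS]mulrA sqrtDE tDE.
Qed.

End sum_of_squares.

(** * Tail bounds *)

Lemma derive_ge0_le (R : realType) (f f' : R -> R) (a b : R) :
  (forall x : R, is_derive x (1 : R) f (f' x)) -> (forall x, 0 <= f' x) -> a <= b ->
  f a <= f b.
Proof.
move=> df f'0 ab; apply: (@ger0_derive1_le_cc _ f a b) => //.
- by move=> x _; rewrite derive1E (@derive_val _ _ _ _ _ _ _ (df x)).
- apply: derivable_within_continuous => x _; by case: (df x).
- by rewrite in_itv/= lexx.
- by rewrite in_itv/= lexx andbT.
Qed.

(** The difference vanishes at 0 and its derivative is [cosh x - 1], which is nonnegative because
    multiplication by [2 * expR x] turns it into [(expR x - 1) ^+ 2]. *)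
Lemma le_sinh (R : realType) (u : R) : 0 <= u -> u <= (expR u - expR (- u)) / 2.
Proof.
move=> u0; pose f (x : R) := (expR x - expR (- x)) / 2 - x.
suff : f 0 <= f u by rewrite /f oppr0 subrr mul0r addr0 subr_ge0.
apply: (@derive_ge0_le _ _ (fun x => (expR x + expR (- x)) / 2 - 1)) => // x.
  rewrite /f; apply: is_derive_eq.
  by rewrite /GRing.scale/=; ring.
have e0 := expR_gt0 x.
rewrite expRN subr_ge0 ler_pdivlMr// mul1r -(ler_pM2r e0) [leRHS]mulrDl mulVf ?gt_eqF//.
by rewrite -subr_ge0 (_ : _ - _ = (expR x - 1) ^+ 2) ?sqr_ge0//; ring.
Qed.

(** The substitution [y = expR x - 1] turns the difference into a function of [x] that vanishes at 0
    and has derivative [(expR x - 1) ^+ 2]. *)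
Lemma ln1D_ge_quadratic (R : realType) (y : R) : 0 <= y -> y - y ^+ 2 / 2 <= ln (1 + y).
Proof.
move=> y0; have y10 : 0 < 1 + y by rewrite ltr_wpDr.
pose f (x : R) := x - (expR x - 1) + (expR x - 1) ^+ 2 / 2.
have : f 0 <= f (ln (1 + y)).
  apply: (@derive_ge0_le _ _ (fun x => (expR x - 1) ^+ 2)) => //.
  - move=> x; rewrite /f; apply: is_derive_eq.
    by rewrite /GRing.scale/=; field.
  - by move=> x; exact: sqr_ge0.
  - by rewrite ln_ge0// lerDl.
rewrite /f expR0 lnK ?posrE// subrr subr0 expr0n mul0r addr0.
by move=> h; rewrite -subr_ge0; apply: (le_trans h); lra.
Qed.

Lemma invr_sqrt_expR (R : realType) (a : R) :
  0 < a -> (Num.sqrt a)^-1 = expR (- (ln a / 2)).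
Proof.
move=> a0; rewrite expRN; congr (_^-1); apply/eqP.
rewrite -(@eqrXn2 _ 2)// ?expR_ge0// sqr_sqrtr ?ltW//.
by rewrite -expRM_natr divfK// lnK.
Qed.

Lemma invr_sqrt1D_le (R : realType) (y : R) :
  0 <= y -> (Num.sqrt (1 + y))^-1 <= expR (- (y / 2) + y ^+ 2 / 4).
Proof.
move=> y0; rewrite invr_sqrt_expR ?ltr_wpDr// ler_expR.
by have := ln1D_ge_quadratic y0; lra.
Qed.

(** [le_sinh] at [- ln (1 - y)] bounds it by [((1 - y)^-1 - (1 - y)) / 2], and half of this is
    exactly the exponent claimed. *)
Lemma invr_sqrt1B_le (R : realType) (y : R) : 0 <= y -> y < 1 ->
  (Num.sqrt (1 - y))^-1 <= expR (y / 2 + y ^+ 2 / (4 * (1 - y))).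
Proof.
move=> y0 y1; have y10 : 0 < 1 - y by rewrite subr_gt0.
rewrite invr_sqrt_expR// ler_expR -mulNr.
have ln0 : 0 <= - ln (1 - y) by rewrite oppr_ge0 ln_le0// gerBl.
have := le_sinh ln0; rewrite opprK expRN lnK ?posrE// => h.
have -> : y / 2 + y ^+ 2 / (4 * (1 - y)) = ((1 - y)^-1 - (1 - y)) / 2 / 2.
  by field; rewrite gt_eqF.
by rewrite ler_pM2r.
Qed.

(** Exponential Markov inequality: the indicator of [E] is at most [expR (s * S w - c)]. The sign of
    [s] is free, so both tails are covered. *)
Lemma probability_le_expR d (T : measurableType d) (R : realType)
    (P : probability T R) (S : {mfun T >-> R}) (E : set T) (s c : R) :
  measurable E -> (forall w, E w -> c <= s * S w) ->
  (P E <= (expR (- c))%:E * \int[P]_w (expR (s * S w))%:E)%E.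
Proof.
move=> mE Ec.
have mexp : measurable_fun [set: T] (fun w => expR (s * S w)).
  by apply: measurableT_comp => //; exact: measurable_funM.
rewrite -ge0_integralZl ?lee_fin ?expR_ge0//; last exact/measurable_EFinP.
have <- : (\int[P]_w (\1_E w)%:E)%E = P E by rewrite integral_indic// setIT.
apply: ge0_le_integral => //.
- by apply/measurable_EFinP; exact: measurable_indic.
- by apply/measurable_EFinP; exact: measurable_funM.
move=> w _; rewrite -EFinM lee_fin -expRD indicE.
have [/set_mem Ew|_] := boolP (w \in E); last exact: expR_ge0.
by rewrite -expR0 ler_expR addrC subr_ge0 Ec.
Qed.

Section tail_bounds.
Context d (T : measurableType d) (R : realType) (W : nat + nat -> {mfun T >-> R}).
Variables (th : nat -> R) (P : probability T R).
Hypothesis Windep : mutually_independent P W.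
Variables (mY sY mX sX : nat -> R).
Hypotheses (sY0 : forall j, 0 < sY j) (sX0 : forall j, 0 < sX j).
Hypothesis WY : forall j, normal_rv P (W (inl j)) (mY j) (sY j).
Hypothesis WX : forall j, normal_rv P (W (inr j)) (mX j) (sX j).

Let w2 j := sY j ^+ 2 + th j ^+ 2 * sX j ^+ 2.
Let mu j := mY j - th j * mX j.

Let w2_gt0 j : 0 < w2 j.
Proof.
apply: ltr_wpDr; last exact: exprn_gt0.
by rewrite !(sqr_ge0, mulr_ge0).
Qed.

Lemma sqr_sum_upper_tail n (L M : R) (E : set T) :
  0 < L -> measurable E -> (forall j, mu j = 0) ->
  (forall j, (j < n.+1)%N -> w2 j <= M) ->
  (forall w, E w -> \sum_(j < n.+1) w2 j
     + 2 * L * Num.sqrt (\sum_(j < n.+1) w2 j ^+ 2) + 2 * L ^+ 2 * M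
     <= sqr_sum W th n.+1 w) ->
  (P E <= (expR (- L ^+ 2))%:E)%E.
Proof.
move=> L0 mE mu0 w2M ES; set Q := Num.sqrt _ in ES.
have Q20 : 0 < \sum_(j < n.+1) w2 j ^+ 2.
  rewrite big_ord_recr/= ltr_wpDl ?exprn_gt0//.
  by apply: sumr_ge0 => j _; exact: sqr_ge0.
have Q0 : 0 < Q by rewrite sqrtr_gt0.
have M0 : 0 < M by apply: lt_le_trans (w2_gt0 0) (w2M _ _).
have ML0 : 0 < 2 * M * L by rewrite !mulr_gt0.
have QM0 : 0 < Q + 2 * M * L by rewrite addr_gt0.
(* This [t] minimizes [- t (2 L Q + 2 L^2 M) + t^2 Q^2 / (1 - 2 t M)], and the minimum is exactly
   [- L^2]. *)
pose t := L / (Q + 2 * M * L).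
have t0 : 0 < t by rewrite divr_gt0.
have tM : 1 - 2 * t * M = Q / (Q + 2 * M * L) by rewrite /t; field; rewrite gt_eqF.
have tM0 : 0 < 1 - 2 * t * M by rewrite tM divr_gt0.
have Dle j : (j < n.+1)%N -> 1 - 2 * t * M <= 1 - 2 * t * w2 j.
  by move=> jn; rewrite lerD2l lerN2 ler_wpM2l ?w2M // mulr_ge0 ?ltW.
have D0 j : (j < n.+1)%N -> 0 < 1 - 2 * t * w2 j.
  by move=> jn; exact: lt_le_trans tM0 (Dle _ jn).
set c := _ + _ + _ in ES.
have Et w : E w -> t * c <= t * sqr_sum W th n.+1 w.
  by move=> Ew; rewrite ler_pM2l// ES.
apply: (le_trans (@probability_le_expR _ _ _ P (sqr_sum W th n.+1) E t (t * c) mE Et)).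
have := @sqr_sum_laplace _ _ _ _ th _ Windep _ _ _ _ sY0 sX0 WY WX (- t) n.+1.
under eq_integral do rewrite opprK.
move=> -> => [|j jn]; last by rewrite mulrN mulNr D0.
rewrite -EFinM lee_fin.
(* The common denominator [1 - 2 t M] lets the quadratic terms add up to a multiple of [Q ^+ 2]. *)
have prodle : \prod_(j < n.+1)
    ((Num.sqrt (1 + 2 * - t * w2 j))^-1 *
     expR (- (- t / (1 + 2 * - t * w2 j)) * mu j ^+ 2)) <=
    \prod_(j < n.+1) expR (t * w2 j + t ^+ 2 * w2 j ^+ 2 / (1 - 2 * t * M)).
  apply: ler_prod => j _; rewrite mulr_ge0 ?expR_ge0//=.
  rewrite mu0 expr0n/= mulr0 expR0 mulr1 mulrN mulNr.
  have y0 : 0 <= 2 * t * w2 j.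
    by apply: mulr_ge0; [apply: mulr_ge0 => //; exact: ltW|exact: ltW].
  have y1 : 2 * t * w2 j < 1 by rewrite -subr_gt0; exact: D0.
  apply: (le_trans (invr_sqrt1B_le y0 y1)); rewrite ler_expR.
  have -> : 2 * t * w2 j / 2 + (2 * t * w2 j) ^+ 2 / (4 * (1 - 2 * t * w2 j)) =
      t * w2 j + t ^+ 2 * w2 j ^+ 2 / (1 - 2 * t * w2 j).
    by field; rewrite subr_eq0 gt_eqF.
  rewrite lerD2l; apply: ler_wpM2l; first by rewrite !(sqr_ge0, mulr_ge0).
  rewrite lef_pV2 ?posrE//; last exact: D0.
  exact: Dle.
apply: le_trans (ler_wpM2l (expR_ge0 _) prodle) _.
rewrite -expR_sum -expRD ler_expR big_split/= -mulr_sumr -mulr_suml -mulr_sumr.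
have Q2 : \sum_(j < n.+1) w2 j ^+ 2 = Q ^+ 2 by rewrite sqr_sqrtr// ltW.
rewrite Q2 tM le_eqVlt; apply/orP; left; apply/eqP; rewrite /c /t.
by field; rewrite !gt_eqF.
Qed.

Lemma sqr_sum_lower_tail n (L : R) (E : set T) :
  0 < L -> measurable E ->
  (forall w, E w -> sqr_sum W th n.+1 w <= \sum_(j < n.+1) (w2 j + mu j ^+ 2)
     - 2 * L * Num.sqrt (\sum_(j < n.+1) (w2 j ^+ 2 + 2 * w2 j * mu j ^+ 2))) ->
  (P E <= (expR (- L ^+ 2))%:E)%E.
Proof.
move=> L0 mE; pose V := \sum_(j < n.+1) (w2 j ^+ 2 + 2 * w2 j * mu j ^+ 2).
rewrite -/V => ES.
have V0 : 0 < V.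
  rewrite /V big_ord_recr/=; apply: ltr_wpDl.
    apply: sumr_ge0 => j _.
    apply: addr_ge0; first exact: sqr_ge0.
    by apply: mulr_ge0; [apply: mulr_ge0 => //; exact: ltW|exact: sqr_ge0].
  apply: ltr_wpDr; last by rewrite exprn_gt0.
  by apply: mulr_ge0; [apply: mulr_ge0 => //; exact: ltW|exact: sqr_ge0].
pose q := Num.sqrt V.
have q0 : 0 < q by rewrite sqrtr_gt0.
have q2 : V = q ^+ 2 by rewrite sqr_sqrtr// ltW.
(* The exponent will be at most [- 2 L t q + t^2 q^2], minimal at this [t] with value [- L^2]. *)
pose t := L / q.
have t0 : 0 < t by rewrite divr_gt0.
have D0 j : 0 < 1 + 2 * t * w2 j.
  apply: ltr_wpDr => //; apply: mulr_ge0; last exact: ltW.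
  by apply: mulr_ge0 => //; exact: ltW.
set c := _ - _ in ES.
have Et w : E w -> - t * c <= - t * sqr_sum W th n.+1 w.
  by move=> Ew; rewrite !mulNr lerN2 ler_pM2l// ES.
apply: (le_trans
  (@probability_le_expR _ _ _ P (sqr_sum W th n.+1) E (- t) (- t * c) mE Et)).
rewrite (@sqr_sum_laplace _ _ _ _ th _ Windep _ _ _ _ sY0 sX0 WY WX t n.+1)
  => [|j _]; last exact: D0.
rewrite -EFinM lee_fin.
have prodle : \prod_(j < n.+1)
    ((Num.sqrt (1 + 2 * t * w2 j))^-1 *
     expR (- (t / (1 + 2 * t * w2 j)) * mu j ^+ 2)) <=
    \prod_(j < n.+1) expR
      (t ^+ 2 * (w2 j ^+ 2 + 2 * w2 j * mu j ^+ 2) - t * (w2 j + mu j ^+ 2)).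
  apply: ler_prod => j _; apply/andP; split; first by rewrite mulr_ge0// expR_ge0.
  have y0 : 0 <= 2 * t * w2 j.
    by apply: mulr_ge0; [apply: mulr_ge0 => //; exact: ltW|exact: ltW].
  apply: (le_trans (ler_wpM2r (expR_ge0 _) (invr_sqrt1D_le y0))).
  rewrite -expRD ler_expR.
  (* Linearizing the inverse makes the noncentral exponent quadratic in [t]; this is the source of
     the term [2 * w2 j * mu j ^+ 2] in [V]. *)
  have h : 1 - 2 * t * w2 j <= (1 + 2 * t * w2 j)^-1.
    rewrite -(ler_pM2r (D0 j)) mulVf ?gt_eqF//.
    by rewrite -subr_sqr expr1n gerBl sqr_ge0.
  have {}h : t * mu j ^+ 2 * (1 - 2 * t * w2 j) <=
      t * mu j ^+ 2 * (1 + 2 * t * w2 j)^-1.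
    by apply: ler_wpM2l h; apply: mulr_ge0; [exact: ltW|exact: sqr_ge0].
  move: h; move: (_^-1) => i h; lra.
apply: le_trans (ler_wpM2l (expR_ge0 _) prodle) _.
rewrite -expR_sum -expRD ler_expR big_split/= sumrN -!mulr_sumr -/V.
rewrite q2 le_eqVlt; apply/orP; left; apply/eqP; rewrite /c -/q /t.
by field; rewrite !gt_eqF.
Qed.

End tail_bounds.

(** * Radii *)

(** Deterministic core of the power bound: the signal [m] covers the threshold, whose quantile [L']
    is enlarged by the union bound, and the deviation [2 L sqrt V]. Since [V] itself grows linearly
    in [m], the last comparison is made between squares. *)
Lemma level_lower_bound (R : realType) (L L' D Q M B V m : R) :
  0 <= L -> 0 <= Q -> 0 <= M -> 1 <= D -> 0 <= L' -> L' ^+ 2 <= L ^+ 2 + D ^+ 2 ->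
  D * Q <= B -> D ^+ 2 * M <= B -> V <= Q ^+ 2 + 2 * M * m ->
  (5 * L + 15 * L ^+ 2 + 5) * B <= m ->
  2 * L * Num.sqrt V + 2 * L' * Q + 2 * L' ^+ 2 * M <= m.
Proof.
move=> L0 Q0 M0 D1 L'0 L'2 QB MB VQ Bm.
have D0 : 0 <= D by exact: le_trans D1.
have QB1 : Q <= B by apply: le_trans QB; rewrite ler_peMl.
have MB1 : M <= B by apply: le_trans MB; rewrite ler_peMl// exprn_ege1.
have B0 : 0 <= B by exact: le_trans QB1.
have L'D : L' <= L + D.
  rewrite -(@ler_pXn2r _ 2)// ?nnegrE ?addr_ge0//; apply: le_trans L'2 _.
  by rewrite sqrrD lerD2r lerDl mulrn_wge0// mulr_ge0.
have L'Q : L' * Q <= (L + 1) * B.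
  apply: (@le_trans _ _ ((L + D) * Q)); first exact: ler_wpM2r.
  by rewrite !mulrDl mul1r lerD// ler_wpM2l.
have L'M : L' ^+ 2 * M <= (L ^+ 2 + 1) * B.
  apply: (@le_trans _ _ ((L ^+ 2 + D ^+ 2) * M)); first exact: ler_wpM2r.
  by rewrite !mulrDl mul1r lerD// ler_wpM2l// sqr_ge0.
have L20 : 0 <= L ^+ 2 by exact: sqr_ge0.
set C := _ + _ in Bm.
have C0 : 0 <= C by rewrite /C; lra.
have m0 : 0 <= m by apply: le_trans Bm; exact: mulr_ge0.
(* [c0 * B] bounds the threshold: it is twice the sum of the bounds [L'Q] and [L'M]. *)
pose c0 := 2 * L + 2 * L ^+ 2 + 4.
have mc0 : 0 <= m - c0 * B.
  rewrite subr_ge0; apply: le_trans Bm; apply: ler_wpM2r => //.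
  by rewrite /C /c0; lra.
suff : 2 * L * Num.sqrt V <= m - c0 * B by rewrite /c0; lra.
rewrite -(@ler_pXn2r _ 2)// ?nnegrE//; last by rewrite mulr_ge0 ?mulr_ge0.
have VB : V <= B ^+ 2 + 2 * B * m.
  apply: (le_trans VQ); apply: lerD; first by rewrite ler_pXn2r// nnegrE.
  by apply: ler_wpM2r => //; apply: ler_wpM2l.
have VB0 : 0 <= B ^+ 2 + 2 * B * m by rewrite addr_ge0 ?sqr_ge0// mulr_ge0// mulr_ge0.
have sV : Num.sqrt V ^+ 2 <= B ^+ 2 + 2 * B * m.
  by rewrite -[leRHS]sqr_sqrtr// ler_pXn2r ?nnegrE ?sqrtr_ge0// ler_wsqrtr.
rewrite exprMn; apply: (le_trans (ler_wpM2l (sqr_ge0 _) sV)).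
(* In terms of the excess [e >= 0], the difference of the squares is a quadratic form in [B] and [e]
   whose coefficients are polynomials in [L]. *)
pose e := m - C * B.
have e0 : 0 <= e by rewrite subr_ge0.
have mE : m = C * B + e by rewrite addrC subrK.
have -> : (m - c0 * B) ^+ 2 = (2 * L) ^+ 2 * (B ^+ 2 + 2 * B * m)
    + (1 + 6 * L - 9 * L ^+ 2 + 38 * L ^+ 3 + 49 * L ^+ 4) * B ^+ 2
    + (2 + 6 * L + 18 * L ^+ 2) * (B * e) + e ^+ 2.
  by rewrite mE /C /c0; ring.
have L30 : 0 <= L ^+ 3 by exact: exprn_ge0.
have L40 : 0 <= L ^+ 4 by exact: exprn_ge0.
have poly0 : 0 <= 1 + 6 * L - 9 * L ^+ 2 + 38 * L ^+ 3 + 49 * L ^+ 4.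
  (* The square [6 L (1 - L)^2] absorbs the only negative term. *)
  have -> : 1 + 6 * L - 9 * L ^+ 2 + 38 * L ^+ 3 + 49 * L ^+ 4 =
    1 + 6 * (L * (1 - L) ^+ 2) + 3 * L ^+ 2 + 32 * L ^+ 3 + 49 * L ^+ 4 by ring.
  have L10 : 0 <= L * (1 - L) ^+ 2 by rewrite mulr_ge0// sqr_ge0.
  lra.
have poly1 : 0 <= 2 + 6 * L + 18 * L ^+ 2 by lra.
move: poly0 poly1; move: (1 + _ + _ + _ + _) (2 + _ + _) => p q p0 q0.
rewrite -!(addrA (_ * (_ + _))) lerDl.
apply: addr_ge0; last exact: sqr_ge0.
by apply: addr_ge0; rewrite mulr_ge0// ?sqr_ge0// mulr_ge0.
Qed.

Lemma inf_attained (R : realType) (K : {fset nat}) (f : nat -> R) : K != fset0 ->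
  exists2 k, k \in K & f k <= inf [set f k | k in [set` K]].
Proof.
move=> /fset0Pn[k0 k0K].
have [k kK kmin] : exists2 k, k \in K & forall j, j \in K -> f k <= f j.
  case: (@arg_minP _ _ K [` k0K] xpredT (fun i => f (val i)) isT) => i _ imin.
  by exists (val i); [exact: valP|move=> j jK; exact: (imin [` jK])].
exists k => //; apply: lb_le_inf; first by exists (f k0), k0.
by move=> _ [j jK <-]; exact: kmin.
Qed.

Lemma ge0_inf (R : realType) (K : set nat) (f : nat -> R) :
  (forall k, 0 <= f k) -> 0 <= inf [set f k | k in K].
Proof.
move=> f0; have [->|/set0P[k Kk]] := eqVneq K set0; first by rewrite image_set0 inf0.
by apply: lb_le_inf; [exists (f k), k|move=> _ [j _ <-]].
Qed.

Section radii.
Context {R : realType}.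
Implicit Types (x a v : nat -> R) (K : {fset nat}) (k : nat).

Lemma max_sq_ge x k j : (j < k.+1)%N -> x j ^+ 2 <= max_sq x k.
Proof.
move=> jk; exact: (le_bigmax _ (fun i : 'I_k.+1 => x i ^+ 2) (Ordinal jk)).
Qed.

Lemma max_sq_ge0 x k : 0 <= max_sq x k.
Proof. by apply: le_trans (max_sq_ge x (ltn0Sn k)); exact: sqr_ge0. Qed.

Lemma max_sqZ c x k : 0 <= c -> max_sq (fun j => c * x j) k = c ^+ 2 * max_sq x k.
Proof.
move=> c0; rewrite /max_sq; elim/big_ind2: _ => [|y1 z1 y2 z2 -> ->|j _].
- by rewrite mulr0.
- by rewrite maxr_pMr// sqr_ge0.
- by rewrite exprMn.
Qed.

Lemma le_max_sq x k l : (k <= l)%N -> max_sq x k <= max_sq x l.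
Proof.
move=> kl; apply: bigmax_le; first exact: max_sq_ge0.
move=> j _; apply: max_sq_ge; exact: (leq_trans (ltn_ord j)).
Qed.

Lemma le_sum_X4 x k l : (k <= l)%N ->
  \sum_(j < k.+1) x j ^+ 4 <= \sum_(j < l.+1) x j ^+ 4.
Proof.
move=> kl; rewrite -!(big_mkord xpredT (fun j => x j ^+ 4)).
rewrite (@big_cat_nat _ _ _ k.+1 0 l.+1)//= lerDl.
by apply: sumr_ge0 => j _; exact: exprn_even_ge0.
Qed.

Lemma sqrt_sum_X4Z c x k : 0 <= c ->
  Num.sqrt (\sum_(j < k.+1) (c * x j) ^+ 4) =
  c ^+ 2 * Num.sqrt (\sum_(j < k.+1) x j ^+ 4).
Proof.
move=> c0; under eq_bigr do rewrite exprMn.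
rewrite -mulr_sumr sqrtrM ?exprn_even_ge0//; congr (_ * _).
by rewrite (exprM c 2 2) sqrtr_sqr ger0_norm// sqr_ge0.
Qed.

(* The minimizers of the two radii over [K] may differ; the smaller of them
   serves both, because the terms weighted by [v_k^-2] increase with [k]. *)
Lemma common_minimizer K a v x (dl : R) : K != fset0 -> weight_seq v ->
  0 <= dl ->
  let rad := Num.max (tauD [set` K] a v (fun j => dl ^+ 2 * x j))
                     (rhoD [set` K] a v (fun j => dl * x j)) in
  exists2 k, k \in K &
    [/\ a k ^+ 2 <= rad ^+ 2,
        dl ^+ 2 * Num.sqrt (\sum_(j < k.+1) x j ^+ 4) <= v k ^+ 2 * rad ^+ 2 &
        (dl ^+ 2) ^+ 2 * max_sq x k <= v k ^+ 2 * rad ^+ 2].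
Proof.
move=> K0 [v0 vnd _] dl0.
set ft := fun k => Num.max ((v k ^+ 2)^-1 * max_sq (fun j => dl ^+ 2 * x j) k) (a k ^+ 2).
set fr := fun k => Num.max ((v k ^+ 2)^-1 *
  Num.sqrt (\sum_(j < k.+1) (dl * x j) ^+ 4)) (a k ^+ 2).
move=> rad.
have [k1 k1K tk] := inf_attained ft K0.
have [k2 k2K rk] := inf_attained fr K0.
have ft0 k : 0 <= ft k by rewrite le_max sqr_ge0 orbT.
have fr0 k : 0 <= fr k by rewrite le_max sqr_ge0 orbT.
have rad0 : 0 <= rad by rewrite le_max sqrtr_ge0.
have {}tk : ft k1 <= rad ^+ 2.
  apply: (le_trans tk); rewrite -[leLHS]sqr_sqrtr ?ge0_inf//.
  by rewrite ler_pXn2r ?nnegrE ?sqrtr_ge0// le_max lexx.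
have {}rk : fr k2 <= rad ^+ 2.
  apply: (le_trans rk); rewrite -[leLHS]sqr_sqrtr ?ge0_inf//.
  by rewrite ler_pXn2r ?nnegrE ?sqrtr_ge0// le_max lexx orbT.
have v20 k : 0 < v k ^+ 2 by rewrite exprn_gt0.
have vle k l : (k <= l)%N -> v l ^+ 2 <= v k ^+ 2.
  by move=> kl; apply: lerXn2r; rewrite ?nnegrE; [exact: ltW|exact: ltW|exact: vnd].
move: tk rk; rewrite /ft /fr !ge_max max_sqZ ?sqr_ge0// sqrt_sum_X4Z//.
rewrite ![(v _ ^+ 2)^-1 * _]mulrC !ler_pdivrMr// ![rad ^+ 2 * _]mulrC.
move=> /andP[tk1 tk2] /andP[rk1 rk2].
exists (minn k1 k2); first by rewrite /minn; case: ifP.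
split.
- by rewrite /minn; case: ifP.
- have le2 := geq_minr k1 k2.
  apply: le_trans (le_trans rk1 _); last by apply: ler_wpM2r; [exact: sqr_ge0|exact: vle].
  by apply: ler_wpM2l; rewrite ?sqr_ge0// ler_wsqrtr// le_sum_X4.
- have le1 := geq_minl k1 k2.
  apply: le_trans (le_trans tk1 _); last by apply: ler_wpM2r; [exact: sqr_ge0|exact: vle].
  by apply: ler_wpM2l; rewrite ?sqr_ge0// le_max_sq.
Qed.

(** * Logarithmic factors *)

Lemma delta_X4 K : (delta K ^+ 2) ^+ 2 = Num.max 1 (ln #|` K|%:R) :> R.
Proof.
rewrite -exprM -powR_mulrn ?powR_ge0// /delta -powRrM mulVf ?pnatr_eq0// powRr1//.
by rewrite le_max ler01.
Qed.

Lemma delta_ge0 K : 0 <= delta K :> R.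
Proof. exact: powR_ge0. Qed.

Lemma delta_sqr_ge1 K : 1 <= delta K ^+ 2 :> R.
Proof.
by rewrite -(@ler_pXn2r _ 2)// ?nnegrE ?sqr_ge0// expr1n delta_X4 le_max lexx.
Qed.

Lemma ln_card_le_delta K : ln #|` K|%:R <= (delta K ^+ 2) ^+ 2 :> R.
Proof. by rewrite delta_X4 le_max lexx orbT. Qed.

Lemma Lfun_sqr (u : R) : 0 < u -> u < 1 -> Defs.Lfun u ^+ 2 = - ln u.
Proof. by move=> u0 u1; rewrite /Defs.Lfun sqr_sqrtr// ltr0_norm// ln_lt0// u0. Qed.

Lemma Lfun_gt0 (u : R) : 0 < u -> u < 1 -> 0 < Defs.Lfun u.
Proof. by move=> u0 u1; rewrite sqrtr_gt0 normr_gt0 lt_eqF// ln_lt0// u0. Qed.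

Lemma expR_Lfun (u : R) : 0 < u -> u < 1 -> expR (- Defs.Lfun u ^+ 2) = u.
Proof. by move=> u0 u1; rewrite Lfun_sqr// opprK lnK. Qed.

Lemma card_div_lt1 K (u : R) : K != fset0 -> 0 < u -> u < 1 ->
  0 < u / #|` K|%:R < 1.
Proof.
rewrite -cardfs_gt0 => K0 u0 u1.
rewrite divr_gt0 ?ltr0n//= ltr_pdivrMr ?ltr0n// mul1r.
by apply: lt_le_trans u1 _; rewrite ler1n.
Qed.

(** The price of the union bound: dividing the level by the cardinality of [K] adds its logarithm to
    the squared quantile, and the fourth power of [delta K] dominates that logarithm. *)
Lemma Lfun_card_sqr_le K (u : R) : K != fset0 -> 0 < u -> u < 1 ->
  Defs.Lfun (u / #|` K|%:R) ^+ 2 <= Defs.Lfun u ^+ 2 + (delta K ^+ 2) ^+ 2.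
Proof.
move=> K0 u0 u1; have /andP[uK0 uK1] := card_div_lt1 K0 u0 u1.
rewrite !Lfun_sqr// ln_div ?posrE ?ltr0n ?cardfs_gt0// opprB addrC lerD2l.
exact: ln_card_le_delta.
Qed.

End radii.

(** * Errors of the max-test *)

Lemma measure_bigcup_seq_le d (T : measurableType d) (R : realType)
    (P : {measure set T -> \bar R}) (I : choiceType) (s : seq I) (F : I -> set T) :
  (forall i, measurable (F i)) ->
  (P (\bigcup_(i in [set` s]) F i) <= \sum_(i <- s) P (F i))%E.
Proof.
move=> mF; rewrite bigcup_seq; elim: s => [|i s IHs].
  by rewrite !big_nil measure0.
rewrite !big_cons; apply: (le_trans (measureU2 _ _ _)) => //; last exact: leeD2l.
exact: bigsetU_measurable.
Qed.

(** * Square summable sequences *)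

Section ell2.
Context {R : realType}.
Implicit Types x y : nat -> R.

Lemma ell2D x y : ell2 x -> ell2 y -> ell2 (x \+ y).
Proof.
move=> lx ly; rewrite /ell2/= /ell2_sqnorm.
have sq0 (z : nat -> R) i : (0 <= (z i ^+ 2)%:E)%E by rewrite lee_fin sqr_ge0.
apply: (@le_lt_trans _ _
  (\sum_(0 <= j <oo) (2%:E * (x j ^+ 2)%:E + 2%:E * (y j ^+ 2)%:E))%E).
  apply: lee_nneseries => // j _; rewrite -!EFinM -EFinD lee_fin -subr_ge0.
  by rewrite (_ : _ - _ = (x j - y j) ^+ 2) ?sqr_ge0//=; ring.
rewrite nneseriesD; [|by move=> i _ _; rewrite mule_ge0..].
by rewrite !nneseriesZl// lte_add_pinfty// lte_mul_pinfty// ltey.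
Qed.

(** The tail bound is the one that [Theta_class] supplies with [c = r * a k ^+ 2]; a separated
    alternative must then have a large head. *)
Lemma ell2_norm_head x k (c : R) : ell2 x ->
  (\sum_(k.+1 <= j <oo) (x j ^+ 2)%:E <= c%:E)%E ->
  ell2_norm x ^+ 2 <= \sum_(j < k.+1) x j ^+ 2 + c.
Proof.
move=> lx xc; have sq0 i : (0 <= (x i ^+ 2)%:E)%E by rewrite lee_fin sqr_ge0.
have x0 : (0 <= ell2_sqnorm x)%E by exact: nneseries_ge0.
rewrite /ell2_norm sqr_sqrtr ?fine_ge0// -lee_fin fineK ?ge0_fin_numE//.
rewrite /ell2_sqnorm (@nneseries_split _ _ 0 k.+1)// add0n EFinD leeD//.
by rewrite big_mkord sumEFin.
Qed.

End ell2.

Lemma measurable_obs_coord (R : realType) (i : nat + nat) :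
  measurable_fun [set: obs_space R] (obs_coord i).
Proof. by case: i => j; [exact: measurable_obsY|exact: measurable_obsX]. Qed.

HB.instance Definition _ (R : realType) i :=
  isMeasurableFun.Build _ _ _ _ (@obs_coord R i) (@measurable_obs_coord R i).

(** * Level and power of the direct statistic *)

Section direct_statistic.
Context {R : realType} (eps sig theta0 : nat -> R).
Hypotheses (heps : forall j, 0 < eps j) (hsig : forall j, 0 < sig j).

Local Notation omega := (omega eps sig theta0).
Local Notation direct_stat := (direct_stat eps sig theta0).
Local Notation coord := (fun i => obs_coord i : {mfun obs_space R >-> R}).

Lemma omega_sqr j : omega j ^+ 2 = eps j ^+ 2 + theta0 j ^+ 2 * sig j ^+ 2.
Proof. by rewrite sqr_sqrtr// !(sqr_ge0, mulr_ge0, addr_ge0). Qed.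

Lemma sum_omega_X4 k : \sum_(j < k.+1) omega j ^+ 4 =
  \sum_(j < k.+1) (eps j ^+ 2 + theta0 j ^+ 2 * sig j ^+ 2) ^+ 2.
Proof. by apply: eq_bigr => j _; rewrite -omega_sqr -exprM. Qed.

Lemma direct_statE k u w : direct_stat k u w = sqr_sum coord theta0 k.+1 w -
  (\sum_(j < k.+1) (eps j ^+ 2 + theta0 j ^+ 2 * sig j ^+ 2)
   + 2 * Defs.Lfun u * Num.sqrt (\sum_(j < k.+1) omega j ^+ 4)
   + 2 * Defs.Lfun u ^+ 2 * max_sq omega k).
Proof.
rewrite /Defs.direct_stat sumrB !opprD !addrA; congr (_ - _ - _ - _).
by apply: eq_bigr => j _; exact: omega_sqr.
Qed.

Lemma measurable_direct_stat_gt0 k u : measurable [set w | 0 < direct_stat k u w].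
Proof.
rewrite (_ : [set w | _] = direct_stat k u @^-1` [set` `]0, +oo[]); last first.
  by apply/seteqP; split => w /=; rewrite in_itv/= andbT.
by apply: measurable_preimage => //; exact: measurable_direct_stat.
Qed.

Lemma measurable_direct_stat_le0 k u :
  measurable [set w | direct_stat k u w <= 0].
Proof.
rewrite (_ : [set w | _] = ~` [set w | 0 < direct_stat k u w]).
  by apply: measurableC; exact: measurable_direct_stat_gt0.
by apply/seteqP; split => w /=; rewrite leNgt => /negP.
Qed.

Variable lambda : nat -> R.

(** Under the null hypothesis the means of [Y_j] and [theta0 j * X_j] cancel, and the critical value
    is that of [sqr_sum_upper_tail] with [L = Lfun u], for which [expR (- L ^+ 2) = u]. *)
Lemma direct_stat_level (P : probability (obs_space R) R) k u :
  is_obs_law eps sig theta0 lambda P -> 0 < u -> u < 1 ->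
  (P [set w | (0 < direct_stat k u w)%R] <= u%:E)%E.
Proof.
move=> [indep PY PX] u0 u1; rewrite -[in leRHS](expR_Lfun u0 u1).
apply: (@sqr_sum_upper_tail _ _ R coord theta0 P indep _ _ _ _ heps hsig PY PX
  k (Defs.Lfun u) (max_sq omega k)).
- exact: Lfun_gt0.
- exact: measurable_direct_stat_gt0.
- by move=> j; rewrite (mulrC (theta0 j)) subrr.
- by move=> j jk; rewrite -omega_sqr; exact: max_sq_ge.
- by move=> w /=; rewrite direct_statE subr_gt0 -sum_omega_X4 => /ltW.
Qed.

Lemma max_test_level (P : probability (obs_space R) R) (K : {fset nat}) u :
  is_obs_law eps sig theta0 lambda P -> K != fset0 -> 0 < u -> u < 1 ->
  (P [set w | max_test eps sig theta0 K u w = true] <= u%:E)%E.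
Proof.
move=> law K0 u0 u1; have /andP[uK0 uK1] := card_div_lt1 K0 u0 u1.
have -> : [set w | max_test eps sig theta0 K u w = true] =
    \bigcup_(k in [set` K]) [set w | 0 < direct_stat k (u / #|` K|%:R) w].
  apply/seteqP; split => w /=.
    by move=> /max_testP[k kK fk]; exists k.
  by move=> [k kK fk]; apply/max_testP; exists k.
apply: (le_trans (@measure_bigcup_seq_le _ _ R P _ K _
  (fun k => measurable_direct_stat_gt0 k (u / #|` K|%:R)))).
apply: (@le_trans _ _ (\sum_(k <- K) (u / #|` K|%:R)%:E)%E).
  by apply: lee_sum => k _; exact: direct_stat_level.
rewrite sumEFin lee_fin big_const_seq count_predT iter_addr_0 -[leLHS]mulr_natr.
by rewrite divfK// pnatr_eq0 -lt0n cardfs_gt0.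
Qed.

(** Here [L'] is the level at which the statistic is run, while [u] is the error allowed. By
    [level_lower_bound], acceptance forces the sum of squares below its mean by at least
    [2 L sqrt V] with [L = Lfun u], an event for [sqr_sum_lower_tail]. *)
Lemma direct_stat_power (P : probability (obs_space R) R) theta k u L' D B :
  is_obs_law eps sig theta lambda P -> 0 < u -> u < 1 -> 1 <= D ->
  Defs.Lfun L' ^+ 2 <= Defs.Lfun u ^+ 2 + D ^+ 2 ->
  D * Num.sqrt (\sum_(j < k.+1) omega j ^+ 4) <= B ->
  D ^+ 2 * max_sq omega k <= B ->
  (5 * Defs.Lfun u + 15 * Defs.Lfun u ^+ 2 + 5) * B <=
    \sum_(j < k.+1) (lambda j * (theta j - theta0 j)) ^+ 2 ->
  (P [set w | (direct_stat k L' w <= 0)%R] <= u%:E)%E.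
Proof.
move=> [indep PY PX] u0 u1 D1 LD QB MB Bm; rewrite -[in leRHS](expR_Lfun u0 u1).
apply: (@sqr_sum_lower_tail _ _ R coord theta0 P indep _ _ _ _ heps hsig PY PX
  k (Defs.Lfun u)).
- exact: Lfun_gt0.
- exact: measurable_direct_stat_le0.
move=> w /=; rewrite direct_statE subr_le0 => /le_trans; apply.
have muE j : lambda j * theta j - theta0 j * lambda j = lambda j * (theta j - theta0 j).
  by rewrite mulrBr (mulrC (theta0 j)).
under [X in _ <= X - _]eq_bigr do rewrite muE.
under [X in _ <= _ - _ * Num.sqrt X]eq_bigr do rewrite muE.
rewrite [X in _ <= X - _]big_split/=.
pose m := \sum_(j < k.+1) (lambda j * (theta j - theta0 j)) ^+ 2.
pose V := \sum_(j < k.+1) ((eps j ^+ 2 + theta0 j ^+ 2 * sig j ^+ 2) ^+ 2 +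
  2 * (eps j ^+ 2 + theta0 j ^+ 2 * sig j ^+ 2) *
  (lambda j * (theta j - theta0 j)) ^+ 2).
rewrite -/m -/V in Bm *.
have VQ : V <= Num.sqrt (\sum_(j < k.+1) omega j ^+ 4) ^+ 2 + 2 * max_sq omega k * m.
  rewrite sqr_sqrtr; last by apply: sumr_ge0 => j _; exact: exprn_even_ge0.
  rewrite sum_omega_X4 /V big_split/= lerD2l mulr_sumr; apply: ler_sum => j _.
  apply: ler_wpM2r; first exact: sqr_ge0.
  by apply: ler_wpM2l => //; rewrite -omega_sqr; exact: max_sq_ge.
have := level_lower_bound (sqrtr_ge0 _) (sqrtr_ge0 _) (max_sq_ge0 omega k) D1
  (sqrtr_ge0 _) LD QB MB VQ Bm.
rewrite -/(Defs.Lfun u) -/(Defs.Lfun L') => h; lra.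
Qed.

End direct_statistic.

(** Acceptance by the maximum implies acceptance at the [k] of [common_minimizer], so the power of
    that single statistic suffices. *)
Lemma max_test_power (R : realType) (eps sig theta0 : nat -> R)
    (heps : forall j, 0 < eps j) (hsig : forall j, 0 < sig j)
    (P : probability (obs_space R) R) (theta lambda a v : nat -> R)
    (K : {fset nat}) (r d A rho u : R) :
  is_obs_law eps sig theta lambda P -> weight_seq v -> Lambda_class d v lambda ->
  Theta_class r a (theta \- theta0) -> K != fset0 -> 0 < r -> 1 <= d ->
  0 < u -> u < 1 -> 0 <= A ->
  r + d * (5 * Defs.Lfun u + 15 * Defs.Lfun u ^+ 2 + 5) <= A ^+ 2 ->
  Num.max (tauD [set` K] a v (fun j => delta K ^+ 2 * omega eps sig theta0 j))
          (rhoD [set` K] a v (fun j => delta K * omega eps sig theta0 j)) <= rho ->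
  A * rho <= ell2_norm (theta \- theta0) ->
  (P [set w | max_test eps sig theta0 K u w = false] <= u%:E)%E.
Proof.
move=> law v_weight [_ lv] [x2 xa] K0 r0 d1 u0 u1 A0 AC radrho rhox.
have [k kK] := common_minimizer a (omega eps sig theta0) K0 v_weight (delta_ge0 K).
set rad := Num.max _ _ in radrho *; move=> [ak QB MB].
have rad0 : 0 <= rad by rewrite le_max sqrtr_ge0.
have [v0 vnd _] := v_weight.
have d0 : 0 < d by exact: lt_le_trans d1.
set C := _ + _ + 5 in AC.
set B := v k ^+ 2 * rad ^+ 2 in QB MB.
have xk := ell2_norm_head x2 (xa k).
have xA : (A * rad) ^+ 2 <= ell2_norm (theta \- theta0) ^+ 2.
  apply: lerXn2r; rewrite ?nnegrE ?mulr_ge0 ?sqrtr_ge0//.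
  by apply: le_trans rhox; exact: ler_wpM2l.
(* Of the separation [(r + d C) rad^2], the part [r rad^2] pays for the tail beyond [k]; the head
   keeps the rest. *)
have xC : d * C * rad ^+ 2 <= \sum_(j < k.+1) (theta j - theta0 j) ^+ 2.
  have rak : r * a k ^+ 2 <= r * rad ^+ 2 by rewrite ler_pM2l.
  have ArC : (r + d * C) * rad ^+ 2 <= A ^+ 2 * rad ^+ 2.
    by apply: ler_wpM2r AC; exact: sqr_ge0.
  by move: xA xk; rewrite exprMn => xA xk; lra.
(* For [j <= k], [lambda_j^2 >= v_j^2 / d >= v_k^2 / d] because [v] is nonincreasing; the factor [d]
   in [xC] cancels this loss. *)
have Bm : C * B <= \sum_(j < k.+1) (lambda j * (theta j - theta0 j)) ^+ 2.
  have vk0 : 0 <= v k ^+ 2 / d by rewrite divr_ge0 ?sqr_ge0// ltW.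
  apply: (@le_trans _ _ (v k ^+ 2 / d * (d * C * rad ^+ 2))).
    by rewrite /B le_eqVlt; apply/orP; left; apply/eqP; field; rewrite gt_eqF.
  apply: (le_trans (ler_wpM2l vk0 xC)); rewrite mulr_sumr; apply: ler_sum => j _.
  rewrite exprMn; apply: ler_wpM2r; first exact: sqr_ge0.
  rewrite ler_pdivrMr// mulrC; apply: le_trans (proj2 (lv j)).
  apply: lerXn2r; rewrite ?nnegrE; [exact: ltW|exact: ltW|].
  by apply: vnd; rewrite -ltnS.
have power := direct_stat_power heps hsig law u0 u1 (delta_sqr_ge1 K)
  (Lfun_card_sqr_le K0 u0 u1) QB MB Bm.
apply: le_trans power; apply: le_measure; rewrite ?inE.
- have := @measurable_max_test R eps sig theta0 K u measurableT [set false] I.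
  by rewrite setTI.
- exact: measurable_direct_stat_le0.
- move=> w /= wK; rewrite leNgt; apply/negP => wk.
  by move: wK; rewrite (max_testP _ _ _ _ _ _).2//; exists k.
Qed.

Theorem theorem3p15 (R : realType)
    (eps sig : nat -> R) (heps : forall j, 0 < eps j)
    (hsig : forall j, 0 < sig j)
    (theta0 : nat -> R) (htheta0 : ell2 theta0)
    (P : (nat -> R) -> (nat -> R) -> probability (obs_space R) R)
    (hP : sequence_model eps sig P)
    (A_class V_class : set (nat -> R))
    (hA_class : forall a, A_class a -> weight_seq a)
    (hV_class : forall v, V_class v -> weight_seq v)
    (r d : R) (hr : 0 < r) (hd : 1 <= d)
    (Keps Ksig K : {fset nat}) (hK : K = (Keps `&` Ksig)%fset)
    (hK0 : K <> fset0)
    (cK : R) (hcK : 1 <= cK)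
    (hcKle : forall a v, A_class a -> V_class v ->
      Num.max (tauD [set` K] a v
                 (fun j => delta K ^+ 2 * omega eps sig theta0 j))
              (rhoD [set` K] a v
                 (fun j => delta K * omega eps sig theta0 j))
      <= cK * rhoD_inflated eps sig theta0 Keps Ksig a v)
    (alpha : R) (halpha0 : 0 < alpha) (halpha1 : alpha < 1)
    (A : R) (hA : Abar r d alpha <= A) :
  (ereal_sup
     [set risk P (max_test eps sig theta0 K (alpha / 2)%R)
            (Theta_class r av.1) (Lambda_class d av.2) theta0
            (A * cK * rhoD_inflated eps sig theta0 Keps Ksig av.1 av.2)%R
     | av in A_class `*` V_class] <= alpha%:E)%E.
Proof.
have KN : K != fset0 by apply/eqP.
have a20 : 0 < alpha / 2 by rewrite divr_gt0.
have a21 : alpha / 2 < 1 by rewrite ltr_pdivrMr// mul1r (lt_trans halpha1)// ltr1n.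
have A0 : 0 <= A by apply: le_trans hA; exact: sqrtr_ge0.
have AC : r + d * (5 * Defs.Lfun (alpha / 2)
    + 15 * Defs.Lfun (alpha / 2) ^+ 2 + 5) <= A ^+ 2.
  have L0 := ltW (Lfun_gt0 a20 a21).
  have C0 : 0 <= 5 * Defs.Lfun (alpha / 2) + 15 * Defs.Lfun (alpha / 2) ^+ 2 + 5.
    by rewrite !addr_ge0// mulr_ge0// sqr_ge0.
  rewrite -[leLHS]sqr_sqrtr; first by rewrite ler_pXn2r ?nnegrE ?sqrtr_ge0.
  by apply: addr_ge0; [exact: ltW|apply: mulr_ge0 => //; exact: le_trans hd].
apply: ge_ereal_sup => _ [[a v] /= [aA vV] <-].
(* Each kind of error receives half of [alpha], the level at which the test is run. *)
rewrite /risk [X in (_ <= X%:E)%E](splitr alpha) EFinD; apply: leeD.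
  apply: ge_ereal_sup => _ [lambda [lambda_bdd _] <-].
  apply: max_test_level => //; exact: hP.
apply: ge_ereal_sup => _ [[theta lambda] /= [xTheta normx lamv] <-].
(* The model fixes the law only for square summable [theta]; the class constrains just the
   difference from [theta0]. *)
have theta2 : ell2 theta.
  rewrite (_ : theta = (theta \- theta0) \+ theta0).
    exact: ell2D xTheta.1 htheta0.
  by apply/funext => j /=; rewrite subrK.
(* Grouping [cK] with the inflated radius gives the quantity that dominates both radii over [K]. *)
have normx' : A * (cK * rhoD_inflated eps sig theta0 Keps Ksig a v) <=
    ell2_norm (theta \- theta0) by rewrite mulrA.
exact: (max_test_power heps hsig (hP _ _ theta2 lamv.1) (hV_class _ vV) lamv xTheta
  KN hr hd a20 a21 A0 AC (hcKle _ _ aA vV) normx').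
Qed.
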